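(* Let $A\in\mathbb{C}^{q\times n}$, let $W\in\mathbb{C}^{n\times q}$ be nonzero, and let $m$ be a positive integer. For $X\in\mathbb{C}^{n\times q}$ the following conditions are equivalent: (1) $X=A^{\mathrm{wg}_m,W,\dag}$; (2) $AX=(A^{\mathrm{cEP},W})^{\star m}WA^{\star m}WAA^{\dag}$ and $X=WA^{D,W}WAX$; (3) $AX=(A^{\mathrm{cEP},W})^{\star m}WA^{\star m}WAA^{\dag}$ and $\mathcal{R}(X)\subseteq\mathcal{R}(WA^{D,W})$.
   Context: $M^{\dag}$ and $\mathcal{R}(M)$ are the Moore-Penrose inverse and range of a complex matrix $M$. For square $M$: $M^0=I$, $\mathrm{Ind}(M)$ is the smallest nonnegative integer $k$ with $\mathrm{rank}(M^k)=\mathrm{rank}(M^{k+1})$; $M^D$ is the Drazin inverse; the core-EP inverse $M^{\mathrm{cEP}}$ is the unique $X$ with $XMX=X$ and $\mathcal{R}(X)=\mathcal{R}(X^* )=\mathcal{R}(M^{\mathrm{Ind}(M)})$. For $X,Y\in\mathbb{C}^{q\times n}$ the $W$-product is $X\star Y=XWY$, and $X^{\star l}$ is the $l$-fold $W$-product of $X$ with itself. The $W$-weighted Drazin inverse is $A^{D,W}=A((WA)^D)^2$; the weighted core-EP inverse is $A^{\mathrm{cEP},W}=A((WA)^{\mathrm{cEP}})^2$; the $W$-weighted $m$-weak group inverse is $A^{\mathrm{wg}_m,W}=(A^{\mathrm{cEP},W})^{\star(m+1)}WA^{\star m}\in\mathbb{C}^{q\times n}$. The $W$-weighted $m$-weak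 group MP inverse is $A^{\mathrm{wg}_m,W,\dag}=WA^{\mathrm{wg}_m,W}WAA^{\dag}\in\mathbb{C}^{n\times q}$. *)

(* Defs.v *)
From mathcomp Require Import all_boot all_order all_algebra.
From mathcomp Require Import boolp classical_sets complex reals.

Set Implicit Arguments.
Unset Strict Implicit.
Unset Printing Implicit Defensive.

Import Order.TTheory GRing.Theory Num.Theory.

Local Open Scope classical_set_scope.
Local Open Scope ring_scope.
Local Open Scope sesquilinear_scope.

Section GeneralizedInverses.
Variable C : numClosedFieldType.

(* The column space, as MathComp's %MS scope deals with row spaces. *)
Definition mxrange p r (M : 'M[C]_(p, r)) : set 'cV[C]_p :=
  [set M *m v | v in [set: 'cV[C]_r]].

(* The three inverses below exist and are unique for every M, so the default
   value 0 of xget is never used. *)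
Definition is_moore_penrose p r (M : 'M[C]_(p, r)) (X : 'M[C]_(r, p)) : Prop :=
  [/\ M *m X *m M = M, X *m M *m X = X,
      (M *m X) ^t* = M *m X & (X *m M) ^t* = X *m M].

Definition moore_penrose p r (M : 'M[C]_(p, r)) : 'M[C]_(r, p) :=
  xget 0 [set X | is_moore_penrose M X].

Lemma ex_mxindex p (M : 'M[C]_p) :
  exists k, \rank (M ^+ k) == \rank (M ^+ k.+1).
Proof.
apply: contrapT => /forallNP H.
have {}H k : (\rank (M ^+ k) + k <= p)%N.
  elim: k => [|k IH]; first by rewrite addn0 rank_leq_row.
  apply: leq_trans IH; rewrite addnS -addSn leq_add2r ltn_neqAle eq_sym.
  apply/andP; split; first exact/negP/H.
  by rewrite exprS mxrankM_maxr.
by have := H p.+1; rewrite addnS ltnNge leq_addl.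
Qed.

Definition mxindex p (M : 'M[C]_p) : nat := ex_minn (ex_mxindex M).

Definition is_drazin p (M X : 'M[C]_p) : Prop :=
  [/\ X *m M *m X = X, M *m X = X *m M &
      M ^+ (mxindex M).+1 *m X = M ^+ mxindex M].

Definition drazin p (M : 'M[C]_p) : 'M[C]_p :=
  xget 0 [set X | is_drazin M X].

Definition is_core_ep p (M X : 'M[C]_p) : Prop :=
  [/\ X *m M *m X = X, mxrange X = mxrange (X ^t*) &
      mxrange (X ^t*) = mxrange (M ^+ mxindex M)].

Definition core_ep p (M : 'M[C]_p) : 'M[C]_p :=
  xget 0 [set X | is_core_ep M X].

Section Weighted.
Variables (q n : nat) (W : 'M[C]_(n, q)).

Definition wprod (X Y : 'M[C]_(q, n)) : 'M[C]_(q, n) := X *m W *m Y.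

(* Meaningful for 0 < l only: wpow X 0 is a junk value. *)
Definition wpow (X : 'M[C]_(q, n)) (l : nat) : 'M[C]_(q, n) :=
  iterop l wprod X 0.

Variable A : 'M[C]_(q, n).

Definition wdrazin : 'M[C]_(q, n) := A *m drazin (W *m A) ^+ 2.

Definition wcore_ep : 'M[C]_(q, n) := A *m core_ep (W *m A) ^+ 2.

Definition weak_group (m : nat) : 'M[C]_(q, n) :=
  wpow wcore_ep m.+1 *m W *m wpow A m.

Definition weak_group_mp (m : nat) : 'M[C]_(n, q) :=
  W *m weak_group m *m W *m A *m moore_penrose A.

End Weighted.
End GeneralizedInverses.

(* Main.v *)
Require Import Defs.
From mathcomp Require Import all_boot all_order all_algebra.
From mathcomp Require Import boolp classical_sets complex reals.

(** Put [M = W A], [D = drazin M] and [E = core_ep M]. Since [W A^{D,W} = D] and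
    [W A^{cEP,W} = M E^2 = E], both [W]-weighted expressions collapse:
    [A^{wg_m,W,dag} = E^(m+1) M^(m+1) A^dag =: X0], and the right-hand side in
    (2) and (3) is [A X0]. Moreover [D M E = E] because [E] has its range in that of
    [M^Ind(M)], so [D M X0 = X0]; and (3) gives [D M X = X], whence
    [X = D W (A X) = D W (A X0) = X0]. *)

Set Implicit Arguments.
Unset Strict Implicit.
Unset Printing Implicit Defensive.

Import Order.TTheory GRing.Theory Num.Theory.

Local Open Scope classical_set_scope.
Local Open Scope ring_scope.

(** Iterating the hypotheses gives [a ^+ k = a ^+ (k + j) * x ^+ j = y ^+ j * a ^+ (k + j)] for all
    [j]. The witness is [a ^+ k * x ^+ k.+1]. *)
Lemma strongly_pi_regular_drazin (S : pzRingType) (a x y : S) (k : nat) :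
  a ^+ k = a ^+ k.+1 * x -> a ^+ k = y * a ^+ k.+1 ->
  exists d, [/\ d * a * d = d, a * d = d * a & a ^+ k.+1 * d = a ^+ k].
Proof.
move=> ax ya.
have axE j : a ^+ (k + j) * x ^+ j = a ^+ k.
  elim: j => [|j IH]; first by rewrite addn0 mulr1.
  rewrite addnS -addSn addnC exprD [x ^+ _]exprS -mulrA (mulrA _ x) -ax.
  by rewrite mulrA -exprD addnC.
have yaE j : y ^+ j * a ^+ (k + j) = a ^+ k.
  elim: j => [|j IH]; first by rewrite addn0 mul1r.
  by rewrite addnS -addSn exprD [y ^+ _]exprSr -mulrA (mulrA y) -ya -exprD.
(* Evaluating [y ^+ j * a ^+ (k + j) * x ^+ j] in two ways lets the witness be written with [x] on
   the right or [y] on the left. *)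
have dE j : a ^+ k * x ^+ j = y ^+ j * a ^+ k.
  by rewrite -{1}(yaE j) -mulrA axE.
have ad : a * (a ^+ k * x ^+ k.+1) = a ^+ k * x ^+ k.
  by rewrite mulrA -exprS [x ^+ _]exprS mulrA -ax.
have da : (a ^+ k * x ^+ k.+1) * a = a ^+ k * x ^+ k.
  by rewrite dE -mulrA -exprSr [y ^+ _]exprSr -mulrA -ya dE.
exists (a ^+ k * x ^+ k.+1); split; last 2 first.
- by rewrite ad da.
- by rewrite exprSr -mulrA ad mulrA -exprD axE.
by rewrite da dE -mulrA (mulrA (a ^+ k)) -exprD mulrA yaE.
Qed.

Section Inverses.
Variable C : numClosedFieldType.

Lemma mxrange_subP p r s (X : 'M[C]_(p, r)) (Y : 'M[C]_(p, s)) :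
  mxrange X `<=` mxrange Y <-> exists Z, X = Y *m Z.
Proof.
split=> [sXY|[Z ->] _ [v _ <-]]; last by exists (Z *m v); rewrite ?mulmxA.
suff /submxP[Z /(congr1 trmx)] : (X^T <= Y^T)%MS.
  by rewrite trmx_mul !trmxK => ->; exists Z^T.
apply/row_subP => i; rewrite -tr_col colE.
have [|v _ <-] := sXY (X *m delta_mx i 0); first by exists (delta_mx i 0).
by rewrite trmx_mul submxMl.
Qed.

Lemma mxindexP p (M : 'M[C]_p) :
  \rank (M ^+ mxindex M) = \rank (M ^+ (mxindex M).+1).
Proof. by rewrite /mxindex; case: ex_minnP => k /eqP. Qed.

(** The row space of [M ^+ k.+1] lies in that of [M ^+ k], and equal ranks at the index make the two
    coincide. Transposing gives [mxindex_factorr]. *)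
Lemma mxindex_factorl p (M : 'M[C]_p) :
  exists Y, M ^+ mxindex M = Y *m M ^+ (mxindex M).+1.
Proof.
apply/submxP.
by rewrite -(geq_leqif (mxrank_leqif_sup _)) ?mxindexP // exprS submxMl.
Qed.

Lemma mxindex_factorr p (M : 'M[C]_p) :
  exists X, M ^+ mxindex M = M ^+ (mxindex M).+1 *m X.
Proof.
suff /submxP[Z /(congr1 trmx)] :
    ((M ^+ mxindex M)^T <= (M ^+ (mxindex M).+1)^T)%MS.
  by rewrite trmx_mul !trmxK => ->; exists Z^T.
rewrite -(geq_leqif (mxrank_leqif_sup _)) ?mxrank_tr ?mxindexP //.
by rewrite exprSr trmx_mul submxMl.
Qed.

Lemma drazinP p (M : 'M[C]_p) : is_drazin M (drazin M).
Proof.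
have [x ax] := mxindex_factorr M; have [y ya] := mxindex_factorl M.
have [d dP] := strongly_pi_regular_drazin ax ya.
by apply: (@xgetPex _ 0 [set X | is_drazin M X]); exists d.
Qed.

Lemma mulmx_drazin_sqr p (M : 'M[C]_p) : M * drazin M ^+ 2 = drazin M.
Proof.
have [dmd md _] := drazinP M.
by rewrite expr2 mulrA [M * _]md -[RHS]dmd.
Qed.

(* The existence of the core-EP inverse is not needed, as what is used of it also
   holds for the default value 0 of [xget]. *)
Lemma core_epP p (M : 'M[C]_p) :
  is_core_ep M (core_ep M) \/ core_ep M = 0.
Proof. by rewrite /core_ep; case: xgetP => [X _ XP|_]; [left|right]. Qed.

Lemma core_ep_factor p (M : 'M[C]_p) :
  exists Z, core_ep M = M ^+ mxindex M *m Z.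
Proof.
have [[_ rE rM]|->] := core_epP M; last by exists 0; rewrite mulmx0.
by apply/mxrange_subP; rewrite rE rM.
Qed.

(* [E M] is idempotent with the range of [M^k], on which it is thus the identity,
   and [E = M^(k+1) Z] for some [Z]: hence [M E E = M (E M) M^k Z = E]. *)
Lemma mulmx_core_ep_sqr p (M : 'M[C]_p) : M * core_ep M ^+ 2 = core_ep M.
Proof.
have [[eme rE rM]|->] := core_epP M; last by rewrite expr2 !mulr0.
have [T MT] : exists T, M ^+ mxindex M = core_ep M *m T.
  by apply/mxrange_subP; rewrite rE rM.
have [Z EZ] := core_ep_factor M; have [x Mx] := mxindex_factorr M.
have emM : core_ep M * M * M ^+ mxindex M = M ^+ mxindex M.
  by rewrite MT -!mulmxE mulmxA eme.
have {}EZ : core_ep M = M * M ^+ mxindex M * (x * Z).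
  by rewrite -exprS mulrA -[X in X * Z]Mx.
by rewrite expr2 {2}EZ !mulrA -(mulrA M _ M) -(mulrA M (_ * M)) emM -mulrA -EZ.
Qed.

Lemma drazin_mul_core_ep p (M : 'M[C]_p) :
  drazin M * M * core_ep M = core_ep M.
Proof.
have [_ md Mk] := drazinP M; have [Z ->] := core_ep_factor M.
(* With [k] the index, commutation turns [D M^(k+1)] into [M^(k+1) D], which is [M^k]; so [D M]
   fixes the left factor of [E]. *)
have comm_md : GRing.comm (drazin M) M by rewrite /GRing.comm -!mulmxE md.
rewrite mulmxE mulrA -(mulrA (drazin M)) -exprS (commrX _ comm_md).
by rewrite [X in X * Z]Mk.
Qed.

Section Weighted.
Variables (q n : nat) (W : 'M[C]_(n, q)).

Lemma wpowS (Y : 'M[C]_(q, n)) l : wpow W Y l.+1 = Y *m (W *m Y) ^+ l.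
Proof.
rewrite /wpow iteropS; elim: l => [|l IH] /=; first by rewrite mulmx1.
by rewrite IH /wprod exprS -mulmxE !mulmxA.
Qed.

(** Positivity matters: [wpow W Y 0] is 0, whereas the power on the right would be the identity. *)
Lemma mulmx_wpow (Y : 'M[C]_(q, n)) l :
  (0 < l)%N -> W *m wpow W Y l = (W *m Y) ^+ l.
Proof. by case: l => // l _; rewrite wpowS mulmxA exprS. Qed.

Variable A : 'M[C]_(q, n).

Lemma mulmx_wdrazin : W *m wdrazin W A = drazin (W *m A).
Proof. by rewrite mulmxA; apply: mulmx_drazin_sqr. Qed.

Lemma mulmx_wcore_ep : W *m wcore_ep W A = core_ep (W *m A).
Proof. by rewrite mulmxA; apply: mulmx_core_ep_sqr. Qed.

Lemma weak_group_mpE m : (0 < m)%N ->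
  weak_group_mp W A m =
  core_ep (W *m A) ^+ m.+1 *m (W *m A) ^+ m.+1 *m moore_penrose A.
Proof.
move=> m_gt0; rewrite /weak_group_mp /weak_group !mulmxA.
rewrite mulmx_wpow // mulmx_wcore_ep -(mulmxA _ W (wpow _ _ _)) mulmx_wpow //.
by rewrite -(mulmxA _ W A) -(mulmxA _ _ (W *m A)) mulmxE -exprSr.
Qed.

Lemma mulmx_weak_group_mp m : (0 < m)%N ->
  wpow W (wcore_ep W A) m *m W *m wpow W A m *m W *m A *m moore_penrose A =
  A *m weak_group_mp W A m.
Proof.
move=> m_gt0; rewrite weak_group_mpE // -(mulmxA _ W (wpow _ _ _)) mulmx_wpow //.
(* Writing the exponent as [m.+1] makes [wpowS] applicable: the power becomes [A E^2 E^m], whose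
   exponent [m + 2] is the one in [X0]. *)
case: m m_gt0 => // m _; rewrite wpowS mulmx_wcore_ep /wcore_ep.
rewrite -(mulmxA _ W A) -(mulmxA _ _ (W *m A)) mulmxE -exprSr -!mulmxE.
by rewrite -(mulmxA A) mulmxE -exprD add2n !mulmxA.
Qed.

Lemma drazin_mul_weak_group_mp m : (0 < m)%N ->
  drazin (W *m A) *m (W *m A) *m weak_group_mp W A m = weak_group_mp W A m.
Proof.
move=> m_gt0; rewrite weak_group_mpE // exprS -mulmxE.
by rewrite !(mulmxA (drazin _ *m _)) [X in X *m _ *m _ *m _]drazin_mul_core_ep.
Qed.

End Weighted.
End Inverses.

Theorem theorem3p7 (R : realType) (q n m : nat)
    (A : 'M[R[i]]_(q, n)) (W : 'M[R[i]]_(n, q))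
    (hW : W <> 0) (hm : (0 < m)%N) (X : 'M[R[i]]_(n, q)) :
  [<-> X = weak_group_mp W A m;
       A *m X = wpow W (wcore_ep W A) m *m W *m wpow W A m *m W *m A
                  *m moore_penrose A
         /\ X = W *m wdrazin W A *m W *m A *m X;
       A *m X = wpow W (wcore_ep W A) m *m W *m wpow W A m *m W *m A
                  *m moore_penrose A
         /\ mxrange X `<=` mxrange (W *m wdrazin W A)].
Proof.
rewrite mulmx_weak_group_mp // mulmx_wdrazin -(mulmxA _ W A).
tfae=> [->|[-> XE]|[AX /mxrange_subP[Z XE]]].
- by rewrite drazin_mul_weak_group_mp.
- split=> //; apply/mxrange_subP; exists (W *m A *m X).
  by rewrite mulmxA.
(* Here [X = D Z], so [D M D = D] gives [D M X = X]. *)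
have [dmd _ _] := drazinP (W *m A).
rewrite -drazin_mul_weak_group_mp // -2!mulmxA -AX !mulmxA -(mulmxA _ W A).
by rewrite XE mulmxA dmd.
Qed.
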